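(* Let $R$ be a (not necessarily commutative) ring with unity and let $I:R\to[0,1]$ be a non-constant fuzzy ideal of $R$. The following fuzzy ideals coincide: (i) the intersection $F_1$ of all semiprime fuzzy ideals of $R$ containing $I$; (ii) the intersection $F_2$ of all prime fuzzy ideals of $R$ containing $I$; (iii) the fuzzy ideal $F_3$ given by $F_3(x)=\sup\{t\in[0,I(0)] : x\in \mathrm{Rad}(I_t)\}$ for $x\in R$.
   Context: Let $R$ be a ring with unity. A (two-sided) fuzzy ideal of $R$ is a map $I:R\to[0,1]$ such that for all $x,y\in R$: $I(x-y)\ge\min\{I(x),I(y)\}$ and $I(xy)\ge\max\{I(x),I(y)\}$. Consequently $I(0)$ is the maximum and $I(1)$ the minimum of $I$. For $t\le I(0)$, the $t$-cut is the two-sided ideal $I_t=\{x\in R: I(x)\ge t\}$. A fuzzy ideal $J$ contains $I$ if $I\le J$ pointwise; the intersection of a family of fuzzy ideals is their pointwise infimum. A non-constant fuzzy ideal $P$ is prime if $\inf_{r\in R}P(xry)=\max\{P(x),P(y)\}$ for all $x,y\in R$, and semiprime if $\inf_{r\in R}P(xrx)=P(x)$ for all $x\in R$. A proper two-sided ideal $Q$ of $R$ is prime if, for $x,y\in R$, $xRy\subseteq Q$ implies $x\in Q$ or $y\in Q$. For a two-sided ideal $A$ of $R$, $\mathrm{Rad}(A)$ is the intersection of all prime ideals of $R$ containing $A$, with $\mathrm{Rad}(R)=R$. *)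

(* Defs.v *)
From HB Require Import structures.
From mathcomp Require Import all_boot all_order all_algebra.
From mathcomp Require Import boolp classical_sets reals.

Set Implicit Arguments.
Unset Strict Implicit.
Unset Printing Implicit Defensive.

Import Order.TTheory GRing.Theory Num.Theory.

Local Open Scope classical_set_scope.
Local Open Scope ring_scope.

(* Ideals of the library's ring_quotient are one-sided on noncommutative
   rings, hence the following two-sided versions, for a possibly
   noncommutative (and possibly zero) unital ring A. *)

Definition is_ideal (A : pzRingType) (Q : set A) : Prop :=
  [/\ Q 0,
      forall x y, Q x -> Q y -> Q (x - y)
    & forall a x, Q x -> Q (a * x) /\ Q (x * a)].

Definition is_prime_ideal (A : pzRingType) (Q : set A) : Prop :=
  [/\ is_ideal Q,
      Q <> setT
    & forall x y, (forall r, Q (x * r * y)) -> Q x \/ Q y].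

(* No prime ideal contains [setT], so [Rad setT] is the empty intersection,
   which is [setT]. *)
Definition Rad (A : pzRingType) (B : set A) : set A :=
  \bigcap_(Q in [set Q | is_prime_ideal Q /\ B `<=` Q]) Q.

Definition is_fuzzy_ideal (A : pzRingType) (R : realType) (I : A -> R) : Prop :=
  [/\ forall x, 0 <= I x <= 1,
      forall x y, Num.min (I x) (I y) <= I (x - y)
    & forall x y, Num.max (I x) (I y) <= I (x * y)].

Definition nonconstant (A : pzRingType) (R : realType) (I : A -> R) : Prop :=
  exists x y, I x <> I y.

Definition fuzzy_subset (A : pzRingType) (R : realType) (I J : A -> R) : Prop :=
  forall x, I x <= J x.

Definition cut (A : pzRingType) (R : realType) (I : A -> R) (t : R) : set A :=
  [set x | t <= I x].

Definition is_prime_fuzzy (A : pzRingType) (R : realType) (P : A -> R) : Prop :=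
  [/\ is_fuzzy_ideal P,
      nonconstant P
    & forall x y, inf [set P (x * r * y) | r in setT] = Num.max (P x) (P y)].

Definition is_semiprime_fuzzy (A : pzRingType) (R : realType) (P : A -> R) :
    Prop :=
  [/\ is_fuzzy_ideal P,
      nonconstant P
    & forall x, inf [set P (x * r * x) | r in setT] = P x].

(* Meaningful for nonempty families only: [inf set0] is 0 by convention. *)
Definition fuzzy_inter (A : pzRingType) (R : realType) (S : set (A -> R)) :
    A -> R :=
  fun x => inf [set P x | P in S].

(* The families below are nonempty when I is a nonconstant fuzzy ideal:
   Q := {x | I x > I 1} is then a proper ideal, and the function equal to 1 on
   a maximal ideal containing Q and to I 1 elsewhere is a prime fuzzy ideal
   containing I. *)

Definition semiprime_inter (A : pzRingType) (R : realType) (I : A -> R) :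
    A -> R :=
  fuzzy_inter [set P : A -> R | is_semiprime_fuzzy P /\ fuzzy_subset I P].

Definition prime_inter (A : pzRingType) (R : realType) (I : A -> R) : A -> R :=
  fuzzy_inter [set P : A -> R | is_prime_fuzzy P /\ fuzzy_subset I P].

Definition cut_radical (A : pzRingType) (R : realType) (I : A -> R) : A -> R :=
  fun x => sup [set t : R | 0 <= t <= I 0 /\ Rad (cut I t) x].

(* Main.v *)
Require Import Defs.
From HB Require Import structures.
From mathcomp Require Import all_boot all_order all_algebra.
From mathcomp Require Import boolp classical_sets reals.

(** All three constructions are compared through the cuts [cut P t], which
    turn fuzzy notions into crisp ones: for [t <= P 0], the cut of a semiprime
    fuzzy ideal [P] at [t] is a semiprime ideal or the whole ring.

    The inclusion of [semiprime_inter I] in [prime_inter I] holds because prime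
    fuzzy ideals are semiprime.  For [cut_radical I] inside
    [semiprime_inter I], let [S] be a semiprime fuzzy ideal containing [I] and
    let [x] lie in the radical of [cut I t].  Then [x] lies in the radical of
    the larger ideal [cut S t], which is its own radical because it is
    semiprime ([Rad_semiprime]); so [t <= S x].  That a semiprime ideal is an
    intersection of primes is the classical theorem of Levitzki and Nagata: a
    point outside the ideal starts a sequence x, x r x, ... avoiding the ideal,
    which is an m-system, and an ideal maximal among those avoiding an m-system
    is prime ([prime_ideal_avoiding]).

    For [prime_inter I] inside [cut_radical I], suppose
    [cut_radical I x < s < prime_inter I x].  Then [x] is outside the radical of
    [cut I s], so some prime ideal [Q] contains that cut and misses [x].  The
    two-valued function equal to [I 0] on [Q] and to [s] elsewhere is a prime
    fuzzy ideal containing [I] with value [s] at [x], a contradiction.  This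
    requires [s < I 0], which is where nonconstancy of [I] enters: it provides
    one prime fuzzy ideal containing [I] and bounded by [I 0]. *)

Set Implicit Arguments.
Unset Strict Implicit.
Unset Printing Implicit Defensive.

Import Order.TTheory GRing.Theory Num.Theory.

Local Open Scope classical_set_scope.
Local Open Scope ring_scope.

(** * Prime ideals avoiding an m-system *)

Section PrimeIdeals.
Variable A : pzRingType.
Implicit Types (B M Q : set A) (x y : A).

Definition m_system M := forall x y, M x -> M y -> exists r, M (x * r * y).

Lemma is_ideal_colon_left Q y :
  is_ideal Q -> is_ideal [set a | forall r, Q (a * r * y)].
Proof.
case=> Q0 QB QM; split=> /= [r|a b Qa Qb r|c a Qa].
- by rewrite !mul0r.
- by rewrite !mulrBl; exact: QB.
- split=> r; first by have [+ _] := QM c _ (Qa r); rewrite !mulrA.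
  by have := Qa (c * r); rewrite !mulrA.
Qed.

Lemma is_ideal_colon_right Q x :
  is_ideal Q -> is_ideal [set b | forall r, Q (x * r * b)].
Proof.
case=> Q0 QB QM; split=> /= [r|a b Qa Qb r|c b Qb].
- by rewrite mulr0.
- by rewrite mulrBr; exact: QB.
- split=> r; first by have := Qb (r * c); rewrite !mulrA.
  by have [_ +] := QM c _ (Qb r); rewrite !mulrA.
Qed.

Lemma is_ideal_bigcup_chain (F : set (set A)) :
    (forall X, F X -> X = set0 \/ is_ideal X) -> total_on F subset ->
  \bigcup_(X in F) X !=set0 -> is_ideal (\bigcup_(X in F) X).
Proof.
move=> Fid Ftot [z [Z FZ Zz]].
have idX X x : F X -> X x -> is_ideal X.
  by move=> FX Xx; case: (Fid _ FX) Xx => // ->.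
split.
- by exists Z => //; case: (idX _ _ FZ Zz).
- move=> x y [X FX Xx] [Y FY Yy].
  have [XY|YX] := Ftot _ _ FX FY.
  + by exists Y => //; case: (idX _ _ FY Yy) => _ + _; apply=> //; exact: XY.
  + by exists X => //; case: (idX _ _ FX Xx) => _ + _; apply=> //; exact: YX.
- move=> a x [X FX Xx]; case: (idX _ _ FX Xx) => _ _ /(_ a x Xx)[? ?].
  by split; exists X.
Qed.

Lemma maximal_ideal_avoiding B M : is_ideal B -> B `&` M = set0 ->
  exists Q, [/\ is_ideal Q, B `<=` Q, Q `&` M = set0 &
    forall C, is_ideal C -> Q `<` C -> C `&` M !=set0].
Proof.
move=> idB BM0.
pose good C := [/\ is_ideal C, B `<=` C & C `&` M = set0].
(* The empty set is admitted because the empty chain has empty union. *)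
have [F Fgood Ftot|Q [Qgood Qmax]] :=
    @Zorn_bigcup _ [set C | C = set0 \/ good C].
  have [->|/set0P U0] := eqVneq (\bigcup_(X in F) X) set0; first by left.
  right; split.
  - apply: is_ideal_bigcup_chain => // X /Fgood[->|[]]; by [left|right].
  - case: U0 => z [Z FZ Zz] b Bb; exists Z => //.
    by case: (Fgood _ FZ) Zz => [->//|[_ + _] _]; apply.
  - rewrite -subset0 => m [[X FX Xm] Mm].
    by case: (Fgood _ FX) Xm => [->//|[_ _ <-]].
have {Qgood}[idQ BQ QM0] : good Q.
  case: Qgood => // Q0; case: (Qmax B); last by right; split.
  rewrite Q0 properEneq; split=> //.
  by case: idB => B0 _ _; apply/eqP => B_; rewrite -B_ in B0.
exists Q; split=> // C idC QC; apply/set0P/eqP => CM0.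
apply: (Qmax C QC); right; split=> //.
by apply: subset_trans BQ _; case: QC.
Qed.

(** An ideal [Q] maximal among those avoiding [M] is prime.  Suppose [x A y] is
    inside [Q] with [x] and [y] outside.  The ideal of all [a] with [a A y]
    inside [Q] contains [x], so it exceeds [Q] and meets [M] in some [m1].  The
    ideal of all [b] with [m1 A b] inside [Q] contains [y], so it meets [M] in
    some [m2].  Then [m1 A m2] is inside [Q], against the m-system property.
    Using these colon ideals instead of the ideals generated by [Q] and [x] or
    [y] avoids computing with sums of products. *)
Lemma prime_ideal_avoiding B M :
    is_ideal B -> M !=set0 -> m_system M -> B `&` M = set0 ->
  exists Q, [/\ is_prime_ideal Q, B `<=` Q & Q `&` M = set0].
Proof.
move=> idB [m0 Mm0] Mm BM0.
have [Q [idQ BQ QM0 Qmax]] := maximal_ideal_avoiding idB BM0.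
have QM0' z : Q z -> M z -> False.
  by move=> Qz Mz; suff : set0 z by []; rewrite -QM0.
have meets C x : is_ideal C -> Q `<=` C -> C x -> ~ Q x -> C `&` M !=set0.
  by move=> idC QC Cx nQx; apply: Qmax => //; split=> // CQ; exact/nQx/CQ.
have [Q0 QB QM] := idQ.
exists Q; split=> //; split=> // [QT|x y Qxy].
  by apply: (QM0' m0) => //; rewrite QT.
apply: contrapT => /not_orP[nQx nQy].
have [|m1 [/= Qm1 Mm1]] := meets _ x (is_ideal_colon_left y idQ) _ Qxy nQx.
  by move=> a Qa r; rewrite -mulrA; apply: (QM _ _ Qa).2.
have [|m2 [/= Qm2 Mm2]] := meets _ y (is_ideal_colon_right m1 idQ) _ Qm1 nQy.
  by move=> b Qb r; apply: (QM _ _ Qb).1.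
by have [r] := Mm _ _ Mm1 Mm2; apply: QM0'.
Qed.

(** Outside a semiprime ideal [Q], each [y] admits [r] with [y r y] again
    outside [Q]; the orbit of [x] under such a map is an m-system, since every
    term is both a left and a right multiple of each earlier one. *)
Lemma Rad_semiprime Q : is_ideal Q ->
  (forall x, (forall r, Q (x * r * x)) -> Q x) -> Rad Q `<=` Q.
Proof.
move=> idQ Qsemi x Qx; apply: contrapT => nQx.
have /choice[g gP] y : exists r, ~ Q y -> ~ Q (y * r * y).
  have [Qy|nQy] := EM (Q y); first by exists 0.
  by have /existsNP[r nQr] := contra_not (Qsemi y) nQy; exists r.
pose s n := iter n (fun y => y * g y * y) x.
have sS n : s n.+1 = s n * g (s n) * s n by [].
have s_mul i d : exists u v, s (d + i)%N = s i * u /\ s (d + i)%N = v * s i.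
  elim: d => [|d [u [v [su sv]]]]; first by exists 1, 1; rewrite mulr1 mul1r.
  set sn := s (d + i)%N in su sv *.
  exists (u * g sn * sn), (sn * g sn * v).
  by rewrite addSn sS -/sn; split; [rewrite {1}su|rewrite {3}sv]; rewrite !mulrA.
have sNQ n : ~ Q (s n) by elim: n => //= n IHn; exact: gP.
have [|||P [P_prime QP PM0]] := @prime_ideal_avoiding Q (range s) idQ.
- by exists x; exists 0%N.
- move=> _ _ [i _ <-] [j _ <-].
  have [[u [_ [su _]]] [_ [v [_ sv]]]] := (s_mul i j, s_mul j i).
  exists (u * g (s (i + j)%N) * v), (i + j).+1 => //.
  by rewrite sS {3}sv addnC su !mulrA.
- by rewrite -subset0 => z [Qz [n _ sn]]; apply: (sNQ n); rewrite sn.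
suff : set0 x by [].
by rewrite -PM0; split; [exact: Qx|exists 0%N].
Qed.

End PrimeIdeals.

(** * Fuzzy ideals and their cuts *)

Section FuzzyIdeals.
Variables (A : pzRingType) (R : realType).
Implicit Types (I P : A -> R) (S : set (A -> R)) (Q : set A) (x y : A).

Lemma fuzzy_ideal_le0 I x : is_fuzzy_ideal I -> I x <= I 0.
Proof. by case=> _ /(_ x x); rewrite subrr minxx. Qed.

Lemma fuzzy_ideal_ge1 I x : is_fuzzy_ideal I -> I 1 <= I x.
Proof. by case=> _ _ /(_ 1 x); rewrite mul1r ge_max => /andP[]. Qed.

Lemma nonconstant_lt I : is_fuzzy_ideal I -> nonconstant I -> I 1 < I 0.
Proof.
move=> If [x [y Ixy]]; rewrite lt_neqAle fuzzy_ideal_le0// andbT.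
apply/eqP => I10; apply: Ixy; have const z : I z = I 0.
  by apply/le_anti; rewrite fuzzy_ideal_le0//= -I10 fuzzy_ideal_ge1.
by rewrite !const.
Qed.

Lemma is_ideal_cut I t : is_fuzzy_ideal I -> t <= I 0 -> is_ideal (cut I t).
Proof.
case=> _ IB IM t0; split=> //= [x y tx ty|a x tx].
  by apply: le_trans (IB x y); rewrite le_min tx.
by split; [apply: le_trans (IM a x)|apply: le_trans (IM x a)];
  rewrite le_max tx ?orbT.
Qed.

(** At [x = y], this makes [t <= P x] equivalent to [x A x] being inside
    [cut P t] when [P] is semiprime: fuzzy semiprimeness passes to the cuts. *)
Lemma le_inf_xry P x y t : is_fuzzy_ideal P ->
  (t <= inf [set P (x * r * y) | r in setT]) <->
  (forall r, t <= P (x * r * y)).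
Proof.
case=> P01 _ _; split=> [tinf r|tP].
  apply: (le_trans tinf); apply: ge_inf; last by exists r.
  by exists 0 => _ [z _ <-]; case/andP: (P01 (x * z * y)).
by apply: lb_le_inf => [|_ [r _ <-]//]; exists (P (x * 0 * y)), 0.
Qed.

Lemma prime_semiprime_fuzzy P : is_prime_fuzzy P -> is_semiprime_fuzzy P.
Proof. by case=> Pf Pn PP; split=> // x; rewrite PP maxxx. Qed.

Lemma Rad_cut_semiprime P t : is_semiprime_fuzzy P -> t <= P 0 ->
  Rad (cut P t) `<=` cut P t.
Proof.
case=> Pf _ PP t0; apply: Rad_semiprime; first exact: is_ideal_cut.
by move=> x /(le_inf_xry x x t Pf); rewrite PP.
Qed.

Lemma Rad_subset (B C : set A) : B `<=` C -> Rad B `<=` Rad C.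
Proof. by move=> BC x Bx Q [Q_prime CQ]; apply: Bx; split=> // y /BC/CQ. Qed.

(** ** Intersections of families of fuzzy ideals *)

Lemma fuzzy_inter_le S P x : S `<=` @is_fuzzy_ideal A R -> S P ->
  fuzzy_inter S x <= P x.
Proof.
move=> Sf SP; apply: ge_inf; last by exists P.
by exists 0 => _ [J /Sf[/(_ x)/andP[J0 _] _ _] <-].
Qed.

Lemma le_fuzzy_inter S x t : S !=set0 -> (forall P, S P -> t <= P x) ->
  t <= fuzzy_inter S x.
Proof.
by move=> [P SP] tS; apply: lb_le_inf => [|_ [J /tS tJ <-]//]; exists (P x), P.
Qed.

Lemma fuzzy_inter_fuzzy_ideal S : S `<=` @is_fuzzy_ideal A R -> S !=set0 ->
  is_fuzzy_ideal (fuzzy_inter S).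
Proof.
move=> Sf S0; split=> [x|x y|x y].
- apply/andP; split.
    by apply: le_fuzzy_inter => // P /Sf[/(_ x)/andP[]].
  have [P SP] := S0; apply: le_trans (fuzzy_inter_le x Sf SP) _.
  by case: (Sf _ SP) => /(_ x)/andP[].
- apply: le_fuzzy_inter => // P SP; have [_ PB _] := Sf _ SP.
  apply: le_trans (PB x y); rewrite le_min !ge_min.
  by rewrite !(fuzzy_inter_le _ Sf SP) orbT.
- apply: le_fuzzy_inter => // P SP; have [_ _ PM] := Sf _ SP.
  apply: le_trans (PM x y); rewrite ge_max !le_max.
  by rewrite !(fuzzy_inter_le _ Sf SP) orbT.
Qed.

(** ** Two-valued prime fuzzy ideals *)

Definition two_valued Q (a b : R) : A -> R :=
  fun x => if `[< Q x >] then a else b.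

Lemma two_valued_in Q a b x : Q x -> two_valued Q a b x = a.
Proof. by rewrite /two_valued => /asboolT ->. Qed.

Lemma two_valued_out Q a b x : ~ Q x -> two_valued Q a b x = b.
Proof. by rewrite /two_valued => /asboolF ->. Qed.

Lemma two_valued_fuzzy_ideal Q a b : is_ideal Q -> 0 <= b -> b <= a -> a <= 1 ->
  is_fuzzy_ideal (two_valued Q a b).
Proof.
move=> [Q0 QB QM] b0 ba a1.
have bnd x : b <= two_valued Q a b x <= a.
  by rewrite /two_valued; case: ifP; rewrite lexx ba.
have ltw x := proj1 (andP (bnd x)); have gtw x := proj2 (andP (bnd x)).
split=> [x|x y|x y].
- by rewrite (le_trans b0 (ltw x)) (le_trans (gtw x) a1).
- have [Qx|/(two_valued_out a b) nQx] := EM (Q x); last by rewrite nQx ge_min ltw.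
  have [Qy|/(two_valued_out a b) nQy] := EM (Q y); last first.
    by rewrite nQy ge_min ltw orbT.
  by rewrite (two_valued_in _ _ (QB _ _ Qx Qy)) ge_min gtw.
- have [Qxy|nQxy] := EM (Q (x * y)); last first.
    rewrite (two_valued_out _ _ nQxy) ge_max !two_valued_out ?lexx// => Qz.
      by apply: nQxy; exact: (QM _ _ Qz).1.
    by apply: nQxy; exact: (QM _ _ Qz).2.
  by rewrite (two_valued_in _ _ Qxy) ge_max !gtw.
Qed.

(** If some [x r y] is outside [Q], then so are [x] and [y], and both sides of
    the fuzzy primality equation are [b]; otherwise primality puts [x] or [y]
    in [Q], and both sides are [a]. *)
Lemma two_valued_prime_fuzzy Q a b :
  is_prime_ideal Q -> 0 <= b -> b < a -> a <= 1 ->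
  is_prime_fuzzy (two_valued Q a b).
Proof.
move=> [idQ QT Qprime] b0 ba a1.
have Pf := two_valued_fuzzy_ideal idQ b0 (ltW ba) a1.
have [Q0 _ _] := idQ.
have [_ _ PM] := Pf.
have bnd x : b <= two_valued Q a b x.
  by rewrite /two_valued; case: ifP => // _; exact: ltW.
split=> //.
- have /existsNP[y nQy] : ~ forall y, Q y.
    by move=> QA; apply: QT; apply/seteqP; split.
  exists 0, y; rewrite two_valued_in// two_valued_out//.
  by move=> ab; rewrite ab ltxx in ba.
- move=> x y; apply/le_anti/andP; split; last first.
    apply/(le_inf_xry _ _ _ Pf) => r; rewrite ge_max.
    have := PM (x * r) y; rewrite ge_max => /andP[xr_le ->]; rewrite andbT.
    by apply: le_trans xr_le; have := PM x r; rewrite ge_max => /andP[].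
  rewrite le_max; set i := inf _.
  have /(le_inf_xry _ _ _ Pf) le_xy : i <= i by [].
  have [/existsNP[r nQr]|/contrapT/Qprime[Qx|Qy]] :=
      EM (~ forall r, Q (x * r * y)).
  + have := le_xy r; rewrite (two_valued_out _ _ nQr) => inf_le_b.
    by rewrite (le_trans inf_le_b (bnd x)).
  + apply/orP; left; apply: le_trans (le_xy 0) _.
    by rewrite mulr0 mul0r (two_valued_in _ _ Q0) (two_valued_in _ _ Qx).
  + apply/orP; right; apply: le_trans (le_xy 0) _.
    by rewrite mulr0 mul0r (two_valued_in _ _ Q0) (two_valued_in _ _ Qy).
Qed.

Lemma fuzzy_subset_two_valued I Q b : is_fuzzy_ideal I ->
  (forall x, b < I x -> Q x) -> fuzzy_subset I (two_valued Q (I 0) b).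
Proof.
move=> If IQ x; have [Qx|nQx] := EM (Q x).
  by rewrite two_valued_in// fuzzy_ideal_le0.
by rewrite two_valued_out// leNgt; apply/negP => /IQ.
Qed.

(** * Comparison of the three radicals *)

(** A function with value [I 1] off a prime [Q] dominates [I] only if [Q]
    contains every [x] with [I 1 < I x].  These [x] form an ideal avoiding the
    m-system reduced to [1], so such a prime exists. *)
Lemma exists_prime_fuzzy_le0 I : is_fuzzy_ideal I -> nonconstant I ->
  exists P, [/\ is_prime_fuzzy P, fuzzy_subset I P & forall x, P x <= I 0].
Proof.
move=> If In; have I10 := nonconstant_lt If In.
have [I01 IB IM] := If.
have idB : is_ideal [set x | I 1 < I x].
  split=> //= [x y x1 y1|a x x1].
    by apply: lt_le_trans (IB x y); rewrite lt_min x1.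
  by split; [apply: lt_le_trans (IM a x)|apply: lt_le_trans (IM x a)];
    rewrite lt_max x1 ?orbT.
have [|||Q [Q_prime BQ _]] := @prime_ideal_avoiding A _ [set 1] idB.
- by exists 1.
- by move=> _ _ -> ->; exists 1; rewrite !mulr1.
- by rewrite -subset0 => z [/= + z1]; rewrite z1 ltxx.
have /andP[I1_ge0 _] := I01 1; have /andP[_ I0_le1] := I01 0.
exists (two_valued Q (I 0) (I 1)); split.
- exact: two_valued_prime_fuzzy.
- exact: fuzzy_subset_two_valued.
- by move=> x; rewrite /two_valued; case: ifP => // _; exact: ltW.
Qed.

Lemma cut_radical_le_semiprime I P x : is_fuzzy_ideal I ->
  is_semiprime_fuzzy P -> fuzzy_subset I P -> cut_radical I x <= P x.
Proof.
move=> If P_semi IP; apply: ge_sup => [|t [/andP[t0 tI0] xt]].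
  (* The cut at 0 is the whole ring, so 0 belongs to the set. *)
  exists 0; split; first by rewrite lexx; case: If => /(_ 0)/andP[].
  move=> Q [_]; apply.
  by case: If => /(_ x)/andP[].
apply: (Rad_cut_semiprime P_semi); first exact: le_trans (IP 0).
by apply: Rad_subset xt => y /= ty; exact: le_trans (IP y).
Qed.

Lemma prime_inter_le_cut_radical I x : is_fuzzy_ideal I -> nonconstant I ->
  prime_inter I x <= cut_radical I x.
Proof.
move=> If In; rewrite leNgt; apply/negP => lt_x.
have [I01 _ _] := If; have /andP[I0_ge0 I0_le1] := I01 0.
have primes_fuzzy : [set P | is_prime_fuzzy P /\ fuzzy_subset I P] `<=`
    @is_fuzzy_ideal A R by move=> P [[]].
have [P0 [P0_prime IP0 P0_le]] := exists_prime_fuzzy_le0 If In.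
have F2_le0 : prime_inter I x <= I 0.
  by apply: le_trans (P0_le x); exact: fuzzy_inter_le.
have F3_ub : has_ubound [set t : R | 0 <= t <= I 0 /\ Rad (cut I t) x].
  by exists (I 0) => t [/andP[]].
have F3_ge0 : 0 <= cut_radical I x.
  apply: ub_le_sup => //; split; first by rewrite lexx.
  by move=> Q [_]; apply; case/andP: (I01 x).
have [lt_s s_lt] := midf_lt lt_x; set s := _ / 2 in lt_s s_lt.
have s_ge0 : 0 <= s := le_trans F3_ge0 (ltW lt_s).
have s_lt0 : s < I 0 := lt_le_trans s_lt F2_le0.
have /existsNP[Q /not_implyP[[Q_prime IQ] nQx]] : ~ Rad (cut I s) x.
  move=> sx; move: lt_s; rewrite ltNge => /negP; apply.
  by apply: ub_le_sup => //; split=> //; rewrite s_ge0 ltW.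
move: s_lt; rewrite ltNge => /negP; apply.
rewrite -(two_valued_out (I 0) s nQx); apply: fuzzy_inter_le => //; split.
  exact: two_valued_prime_fuzzy.
by apply: fuzzy_subset_two_valued => // y /ltW/IQ.
Qed.

End FuzzyIdeals.

Theorem corollary5p6 (A : pzRingType) (R : realType) (I : A -> R)
    (I_fuzzy : is_fuzzy_ideal I) (I_nonconstant : nonconstant I) :
  [/\ is_fuzzy_ideal (semiprime_inter I),
      is_fuzzy_ideal (prime_inter I) &
      is_fuzzy_ideal (cut_radical I)] /\
  [/\ semiprime_inter I = prime_inter I &
      prime_inter I = cut_radical I].
Proof.
have [P [P_prime IP _]] := exists_prime_fuzzy_le0 I_fuzzy I_nonconstant.
have prime_semi J : is_prime_fuzzy J /\ fuzzy_subset I J ->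
    is_semiprime_fuzzy J /\ fuzzy_subset I J.
  by case=> /prime_semiprime_fuzzy.
have F1_le_F2 x : semiprime_inter I x <= prime_inter I x.
  apply: le_fuzzy_inter => [|J /prime_semi IJ]; first by exists P.
  by apply: fuzzy_inter_le => // K [[]].
have F3_le_F1 x : cut_radical I x <= semiprime_inter I x.
  apply: le_fuzzy_inter => [|J [J_semi IJ]].
    by exists P; exact: prime_semi.
  exact: cut_radical_le_semiprime.
have F2_le_F3 x := prime_inter_le_cut_radical x I_fuzzy I_nonconstant.
have E12 : semiprime_inter I = prime_inter I.
  apply/funext => x; apply/le_anti; rewrite F1_le_F2/=.
  exact: le_trans (F2_le_F3 x) (F3_le_F1 x).
have E23 : prime_inter I = cut_radical I.
  apply/funext => x; apply/le_anti; rewrite F2_le_F3/=.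
  exact: le_trans (F3_le_F1 x) (F1_le_F2 x).
have F2_fuzzy : is_fuzzy_ideal (prime_inter I).
  by apply: fuzzy_inter_fuzzy_ideal; [move=> J [[]]|exists P].
by rewrite -E23 E12.
Qed.
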